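(* Let $q$ be a prime power, $r>1$ an integer, and $u$ a positive integer with $u\mid\frac{q^r-1}{q-1}$. Let $\mathcal{NT}_u:=\{(x,y)\in\mathbb{F}_{q^r}^2 : x^u=\mathcal{T}_{\mathbb{F}_{q^r}/\mathbb{F}_q}(y)\}$. Then the ideal of all polynomials in $\mathbb{F}_{q^r}[X,Y]$ which vanish at every point of $\mathcal{NT}_u$ is generated by $X^u-\mathcal{T}_{\mathbb{F}_{q^r}/\mathbb{F}_q}(Y)$ and $X^{u(q-1)+1}-X$.
   Context: $\mathcal{T}_{\mathbb{F}_{q^r}/\mathbb{F}_q}(Y)=\sum_{i=0}^{r-1}Y^{q^i}$, both as a polynomial and as the trace map $\mathbb{F}_{q^r}\to\mathbb{F}_q$. *)

(* Defs.v *)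
From HB Require Import structures.
From mathcomp Require Import all_boot all_order all_algebra all_field.
From mathcomp Require Import mpoly.

Set Implicit Arguments.
Unset Strict Implicit.
Unset Printing Implicit Defensive.

Import GRing.Theory.
Local Open Scope ring_scope.

Definition prime_power (q : nat) : Prop :=
  exists p k : nat, [/\ prime p, (0 < k)%N & q = (p ^ k)%N].

(* The ring A is arbitrary so that the same formula gives both the trace map
   (A the field F_{q^r}; the values then lie in its subfield F_q) and the trace
   polynomial T(Y) (A a polynomial ring, y := Y). *)
Definition trace (q r : nat) (A : nzRingType) (y : A) : A :=
  \sum_(i < r) y ^+ (q ^ i).

Definition NT (q r u : nat) (F : finFieldType) : {set F * F} :=
  [set z | z.1 ^+ u == trace q r z.2].

(* The variable 'X_0 is evaluated at z.1 and the variable 'X_1 at z.2. *)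
Definition vanishing_ideal (F : finFieldType) (S : {set F * F}) :
    {pred {mpoly F[2]}} :=
  [pred P : {mpoly F[2]} | [forall z in S, P.@[tnth [tuple z.1; z.2]] == 0]].

Definition ideal_gen (A : comNzRingType) (gs : seq A) (P : A) : Prop :=
  exists c : 'I_(size gs) -> A, P = \sum_(i < size gs) c i * gs`_i.

(* Main.v *)
(** Put T for the trace polynomial. Modulo X^u - T(Y), which up to sign is monic
    of degree q^(r-1) in Y, a polynomial P reduces to some R(X, Y) of smaller
    degree in Y. If x^(u(q-1)+1) = x then c := x^u satisfies c^q = c, so
    T(Y) - c divides (T(Y) - c)^q - (T(Y) - c) = Y^(q^r) - Y and all its roots
    are simple and lie in F. Hence R(x, Y) has more roots than its degree and
    vanishes, i.e. every coefficient of R in F[X] vanishes at the roots of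
    X^(u(q-1)+1) - X. As u(q-1) divides q^r - 1, that polynomial divides
    X^(q^r) - X, so it divides each coefficient of R. *)
Require Import Defs.
From HB Require Import structures.
From mathcomp Require Import all_boot all_order all_algebra all_field.
From mathcomp Require Import mpoly.

Set Implicit Arguments.
Unset Strict Implicit.
Unset Printing Implicit Defensive.

Import GRing.Theory.
Local Open Scope ring_scope.

(** ['X^#|F| - 'X] is the product of the distinct ['X - a] for [a] in [F], so up to a unit [g] is a
    subproduct without repeated roots. *)
Lemma finField_dvdpP (F : finFieldType) (g f : {poly F}) :
  g %| 'X^#|F| - 'X -> (forall x, root g x -> root f x) -> g %| f.
Proof.
rewrite finField_genPoly => /dvdp_prod_XsubC[m g_prod] g_f.
rewrite (eqp_dvdl _ g_prod); apply: uniq_roots_dvdp.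
  apply/allP=> x x_m; apply: g_f.
  by rewrite (eqp_root g_prod) root_prod_XsubC.
by rewrite uniq_rootsE mask_uniq // /index_enum -enumT enum_uniq.
Qed.

Section Trace.

Variables (A B : comNzRingType) (q r : nat).

Lemma rmorph_trace (f : {rmorphism A -> B}) (y : A) :
  f (trace q r y) = trace q r (f y).
Proof. by rewrite rmorph_sum; apply: eq_bigr => i _; rewrite rmorphXn. Qed.

Hypothesis char_q : [pchar A].-nat q.

(** The map [x ^+ q] is additive here and shifts each summand to the next one, so the difference
    telescopes. *)
Lemma trace_expB (y : A) : trace q r y ^+ q - trace q r y = y ^+ (q ^ r) - y.
Proof.
have q_gt0 : (0 < q)%N by case/andP: char_q.
rewrite /trace; elim: r => [|s IHs].
  by rewrite !big_ord0 expr0n gtn_eqF // expn0 expr1 !subrr.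
rewrite !big_ord_recr /= exprDn_pchar // -exprM -expnSr opprD addrACA IHs.
by rewrite addrC subrKA.
Qed.

End Trace.

Lemma horner_traceX (A : comNzRingType) (q r : nat) (y : A) :
  (trace q r 'X).[y] = trace q r y.
Proof.
rewrite -[LHS]/(horner_eval y _) rmorph_trace /=.
by rewrite /horner_eval hornerX.
Qed.

(** The ring is general because this serves twice: over [F] with [c] a scalar, and over [{poly F}]
    with [c] equal to ['X^u]. *)
Lemma trace_polyX_subC (A : nzRingType) (q r : nat) (c : A) : (1 < q)%N ->
  trace q r.+1 'X - c%:P \is monic /\
  size (trace q r.+1 'X - c%:P) = (q ^ r).+1.
Proof.
move=> q_gt1; rewrite /trace big_ord_recr /= -addrA addrC -addrA addrC.
set low := - c%:P + _.
have low_small : (size low < size ('X^(q ^ r) : {poly A}))%N.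
  rewrite size_polyXn ltnS (leq_trans (size_polyD _ _)) // geq_max size_polyN.
  rewrite (leq_trans (size_polyC_leq1 _)) ?expn_gt0 ?(ltnW q_gt1) //=.
  apply: leq_trans (size_sum _ _ _) _; apply/bigmax_leqP=> i _.
  by rewrite size_polyXn ltn_exp2l.
rewrite addrC monicE lead_coefDl // size_polyDl // lead_coefXn eqxx.
by rewrite size_polyXn.
Qed.

Section BivariatePoly.

Variable A : comNzRingType.

(* The inner variable is sent to 'X_0 and the outer one to 'X_1. *)
Definition mpoly_of_poly2 : {poly {poly A}} -> {mpoly A[2]} :=
  horner_morph (fun c => mulrC 'X_1 (horner_alg ('X_0 : {mpoly A[2]}) c)).

HB.instance Definition _ := GRing.RMorphism.on mpoly_of_poly2.

Lemma mpoly_of_poly2X : mpoly_of_poly2 'X = 'X_1.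
Proof. exact: horner_morphX. Qed.

Lemma mpoly_of_poly2CX : mpoly_of_poly2 'X%:P = 'X_0.
Proof. by rewrite /mpoly_of_poly2 horner_morphC; exact: horner_algX. Qed.

Lemma mpoly_of_poly2CC c : mpoly_of_poly2 c%:P%:P = c%:MP.
Proof.
by rewrite /mpoly_of_poly2 horner_morphC -alg_mpolyC; exact: horner_algC.
Qed.

Lemma mpoly_of_poly2_traceB q r u :
  mpoly_of_poly2 (trace q r 'X - ('X^u)%:P) = trace q r 'X_1 - 'X_0 ^+ u.
Proof.
rewrite rmorphB rmorph_trace /= mpoly_of_poly2X polyC_exp rmorphXn /=.
by rewrite mpoly_of_poly2CX.
Qed.

Lemma mpoly_of_poly2C_XnB n :
  mpoly_of_poly2 ('X^n - 'X)%:P = 'X_0 ^+ n - 'X_0.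
Proof. by rewrite polyCB polyC_exp rmorphB rmorphXn /= mpoly_of_poly2CX. Qed.

(** Allows a polynomial in two variables to be divided with remainder as a polynomial in ['X_1]
    alone. *)
Lemma mpoly_of_poly2_surj P : exists Q, P = mpoly_of_poly2 Q.
Proof.
elim/mpolyind: P => [|c m P _ _ [Q ->]]; first by exists 0; rewrite rmorph0.
exists (c%:P%:P * ('X%:P ^+ m ord0 * 'X ^+ m (lift ord0 ord0)) + Q).
rewrite rmorphD !rmorphM !rmorphXn /= mpoly_of_poly2CC mpoly_of_poly2X.
rewrite mpoly_of_poly2CX mul_mpolyC [X in c *: X](mpolyXE_id) big_ord_recl.
by rewrite big_ord1.
Qed.

Lemma meval_mpoly_of_poly2 v Q :
  (mpoly_of_poly2 Q).@[v] = (map_poly (horner_eval (v ord0)) Q).[v ord_max].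
Proof.
rewrite /mpoly_of_poly2 /horner_morph -(mevalXU v ord_max).
rewrite -horner_map /= -map_poly_comp; congr (_.[_]).
apply: eq_map_poly => c /=.
rewrite /horner_alg /horner_morph /= -horner_map /= -map_poly_comp.
rewrite mevalXU map_poly_id //= => a _.
by rewrite alg_mpolyC mevalC.
Qed.

End BivariatePoly.

Lemma ideal_gen2P (A : comNzRingType) (g h P : A) :
  ideal_gen [:: g; h] P <-> exists a b, P = a * g + b * h.
Proof.
split=> [[c ->]|[a [b ->]]].
  by exists (c ord0), (c (lift ord0 ord0)); rewrite big_ord_recl big_ord1.
exists (fun i => if i == ord0 then a else b).
by rewrite big_ord_recl big_ord1.
Qed.

Section NormTrace.

Variables (q r u : nat) (F : finFieldType).
Hypotheses (char_q : [pchar F].-nat q) (q_gt1 : (1 < q)%N) (u_gt0 : (0 < u)%N).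
Hypothesis card_F : #|F| = (q ^ r.+1)%N.

Let char_q_poly : [pchar {poly F}].-nat q.
Proof. by rewrite (eq_pnat _ (pchar_poly F)). Qed.

Lemma trace_expq (y : F) : trace q r.+1 y ^+ q = trace q r.+1 y.
Proof.
by apply/eqP; rewrite -subr_eq0 trace_expB // -card_F expf_card subrr.
Qed.

Lemma traceX_subC_dvd (c : F) : c ^+ q = c ->
  trace q r.+1 'X - c%:P %| 'X^#|F| - 'X.
Proof.
move=> c_q; set g := trace q r.+1 'X - c%:P.
have ->: 'X^#|F| - 'X = g ^+ q - g.
  have cP_q : trace q r.+1 'X ^+ q = g ^+ q + c%:P.
    by rewrite -[X in _ + X%:P]c_q rmorphXn -exprDn_pchar // subrK.
  by rewrite card_F -trace_expB // cP_q opprB addrA addrAC.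
by rewrite -[X in _ - X]mulr1 -(prednK (ltnW q_gt1)) exprS -mulrBr dvdp_mulIl.
Qed.

(** Otherwise [f] would be a nonzero multiple of [trace q r.+1 'X - c%:P], whose degree is
    [q ^ r]. *)
Lemma traceX_subC_eq0 (c : F) (f : {poly F}) : c ^+ q = c ->
  (size f <= q ^ r)%N -> (forall y, trace q r.+1 y = c -> f.[y] = 0) -> f = 0.
Proof.
move=> c_q f_small f_roots; apply/eqP/negPn/negP => f_n0.
have [_ g_size] := trace_polyX_subC r c q_gt1.
suff /(dvdp_leq f_n0) : trace q r.+1 'X - c%:P %| f.
  by rewrite g_size ltnNge f_small.
apply: finField_dvdpP (traceX_subC_dvd c_q) _ => y.
by rewrite /root !hornerE horner_traceX subr_eq0 => /eqP/f_roots->.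
Qed.

(** Both equations say that [x = 0] or [x ^+ (u * (q - 1)) = 1]. *)
Lemma expuX_fixed (x : F) :
  (x ^+ u) ^+ q = x ^+ u <-> x ^+ (u * (q - 1) + 1) = x.
Proof.
have uq : (u * q = u * (q - 1) + u)%N.
  by rewrite -mulnSr subn1 prednK // ltnW.
rewrite -exprM uq !exprD expr1; have [->|x_n0] := eqVneq x 0.
  by rewrite !expr0n (gtn_eqF u_gt0) !mulr0.
split=> [|/(canRL (mulfK x_n0))]; last by rewrite divff // => ->; rewrite mul1r.
by move/(canRL (mulfK (expf_neq0 u x_n0))); rewrite divff ?expf_neq0 // => ->;
  rewrite mul1r.
Qed.

Hypothesis u_dvd : (u %| (q ^ r.+1 - 1) %/ (q - 1))%N.

(** With [n = u * (q - 1)] and [n * m = #|F| - 1], cancelling the common factor ['X] leaves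
    ['X^n - 1], which divides ['X^(n * m) - 1]. *)
Lemma expX_subX_dvd :
  ('X^(u * (q - 1) + 1) - 'X : {poly F}) %| 'X^#|F| - 'X.
Proof.
have /dvdnP[m card_m] : (u * (q - 1) %| q ^ r.+1 - 1)%N.
  by rewrite -dvdn_divRL ?subn1 ?dvdn_pred_predX // -!subn1.
have ->: #|F| = (u * (q - 1) * m + 1)%N.
  by rewrite card_F mulnC -card_m subnK // expn_gt0 ltnW.
rewrite !exprD !expr1 -[X in _ - X]mul1r -[X in _ %| _ - X]mul1r -!mulrBl.
have := subrXX ('X^(u * (q - 1)) : {poly F}) 1 m; rewrite expr1n -exprM => ->.
by rewrite dvdp_mul2r ?polyX_eq0 // dvdp_mulIl.
Qed.

End NormTrace.

Theorem lemma9 (q r u : nat) (F : finFieldType)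
    (hq : prime_power q) (hr : (1 < r)%N) (hF : #|F| = (q ^ r)%N)
    (hu0 : (0 < u)%N) (hu : (u %| (q ^ r - 1) %/ (q - 1))%N) :
  let X : {mpoly F[2]} := 'X_0 in
  let Y : {mpoly F[2]} := 'X_1 in
  forall P : {mpoly F[2]},
    P \in vanishing_ideal (NT q r u F) <->
    ideal_gen [:: X ^+ u - trace q r Y; X ^+ (u * (q - 1) + 1) - X] P.
Proof.
move=> X Y P; rewrite ideal_gen2P.
have [p [k [p_pr k_gt0 def_q]]] := hq.
have q_gt1 : (1 < q)%N by rewrite def_q -(exp1n k) ltn_exp2r ?prime_gt1.
have char_q : [pchar F].-nat q.
  have p_char : p \in [pchar F].
    by apply: (@card_finPcharP _ _ (k * r)); rewrite // hF def_q expnM.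
  by rewrite (eq_pnat _ (pcharf_eq p_char)) def_q pnatX pnat_id.
case: r hr hF hu => // s _ hF hu.
have evalX v : X.@[v] = v ord0 by rewrite mevalXU.
have evalY v : Y.@[v] = v ord_max.
  by rewrite mevalXU; congr v; apply: val_inj.
split=> [/forallP P0|[a [b ->]]]; last first.
  apply/forallP=> -[x y]; apply/implyP; rewrite inE /= => /eqP x_y.
  (* As a trace value, [x ^+ u] is fixed by the [q]-th power, so the second generator vanishes at
     [x]. *)
  have /(expuX_fixed q_gt1 hu0) x_fix : (x ^+ u) ^+ q = x ^+ u.
    by rewrite x_y trace_expq.
  rewrite !(mevalD, mevalM, mevalN, rmorphXn) /= rmorph_trace /= evalX evalY.
  by rewrite !(tnth_nth 0) /= x_y x_fix !subrr !mulr0 addr0.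
have [Q def_P] := mpoly_of_poly2_surj P.
set G : {poly {poly F}} := trace q s.+1 'X - ('X^u)%:P.
have [G_monic G_size] := trace_polyX_subC s ('X^u : {poly F}) q_gt1.
set D : {poly F} := 'X^(u * (q - 1) + 1) - 'X.
have mpolyG : mpoly_of_poly2 G = - (X ^+ u - trace q s.+1 Y).
  by rewrite opprB; exact: mpoly_of_poly2_traceB.
have mpolyD : mpoly_of_poly2 D%:P = X ^+ (u * (q - 1) + 1) - X.
  exact: mpoly_of_poly2C_XnB.
(* The coefficients lie in [{poly F}], which is not a field; the division is exact in this form
   because [G] is monic. *)
have def_Q := Pdiv.RingMonic.rdivp_eq G_monic Q.
set A := Pdiv.CommonRing.rdivp _ _ in def_Q.
set R := Pdiv.CommonRing.rmodp _ _ in def_Q.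
have R_size : (size R <= q ^ s)%N.
  by rewrite -ltnS -G_size Pdiv.CommonRing.ltn_rmodpN0 ?monic_neq0.
have D_dvd i : D %| R`_i.
  apply: finField_dvdpP (expX_subX_dvd q_gt1 hF hu) _ => x.
  rewrite /root !hornerE subr_eq0 => /eqP/(expuX_fixed q_gt1 hu0) x_fix.
  have R_x0 : map_poly (horner_eval x) R = 0.
    apply: (traceX_subC_eq0 char_q q_gt1 hF x_fix) => [|y x_y].
      exact: leq_trans (size_poly _ _) R_size.
    have xy_NT : (x, y) \in NT q s.+1 u F by rewrite inE /= x_y.
    have /eqP := implyP (P0 (x, y)) xy_NT.
    (* The multiple of [G] vanishes at [(x, y)], so [R] takes the same value there as [P], namely
       0. *)
    rewrite def_P meval_mpoly_of_poly2 !(tnth_nth 0) /= def_Q.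
    rewrite rmorphD rmorphM /G rmorphB rmorph_trace /= map_polyX map_polyC /=.
    rewrite /horner_eval hornerXn !hornerE horner_traceX x_y subrr mulr0.
    by rewrite add0r.
  by rewrite -[_.[x]]/(horner_eval x _) -coef_map R_x0 coef0.
have def_R : R = map_poly (fun c => c %/ D) R * D%:P.
  apply/polyP=> i; rewrite coefMC coef_map_id0 ?div0p //.
  by rewrite divpK.
(* The sign appears because [G], chosen monic, maps to the opposite of the first generator. *)
exists (- mpoly_of_poly2 A), (mpoly_of_poly2 (map_poly (fun c => c %/ D) R)).
by rewrite mulNr -mulrN -mpolyG -mpolyD -!rmorphM -rmorphD -def_R -def_Q.
Qed.
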